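(* Let $\Phi$ be a QCNF that fulfils the $XT$-property and requires Q-resolution refutations of size $s$. Then each long-distance QCDCL resolution refutation of $\Phi$ (and therefore also each $\mathsf{QCDCL}^{\textsf{LEV-ORD}}_{\textsf{RED}}$ refutation of $\Phi$) has size at least $s$. In fact, each long-distance QCDCL resolution refutation of $\Phi$ is a Q-resolution refutation.
   Context: QBF basics. A literal is a variable $x$ or $\bar x$; a clause is a disjunction of literals identified with its set of literals; $(\bot)$ is the empty clause; a clause is tautological if it contains $x$ and $\bar x$. A QCNF is $\Phi=\mathcal{Q}\cdot\phi$ with prefix $\mathcal{Q}=Q_1X_1\dots Q_sX_s$ (disjoint nonempty variable sets, alternating quantifiers $Q_i\in\{\exists,\forall\}$) and matrix $\phi$ a CNF of non-tautological clauses. $\mathrm{lv}(x)=i$ if the variable of $x$ is in $X_i$; variables in $\exists$-blocks are existential, others universal. $\mathrm{red}(C)$ deletes from $C$ every universal literal $v$ with $\mathrm{lv}(v)>\mathrm{lv}(x)$ for all existential $x\in C$. For existential $\ell$ whose variable is not in $C_1,C_2$: $(C_1\vee\ell)\otimes_\ell(C_2\vee\bar\ell)=C_1\vee C_2$. A Q-resolution proof of $C$ is a sequence $C_1,\dots,C_m=C$ with each $C_i\in\phi$, or a non-tautological resolvent $C_j\otimes_x C_k$ ($j,k<i$, $x$ existential), or $\mathrm{red}(C_j)$ ($j<i$). A long-distance Q-resolution proof is the same except that resolvents may contain complementary universal literals $u,\bar u$, provided that whenever the variable $u$ occurs in both parents, $\mathrm{lv}(u)>\mathrm{lv}(x)$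 for the pivot $x$. Size = number of clauses; a refutation proves $(\bot)$. QCDCL. $C|_\sigma=\top$ if $C\cap\sigma\ne\emptyset$, else the clause of all $\ell\in C$ with $\bar\ell\notin\sigma$. A trail for $\Phi=\mathcal{Q}\cdot\phi$ is a sequence $\mathcal{T}=(p_{(0,1)},\dots,p_{(0,g_0)};d_1,p_{(1,1)},\dots;\dots;d_r,p_{(r,1)},\dots,p_{(r,g_r)})$ of literals in which no variable occurs twice; $d_i$ are decision literals, $p_{(i,j)}$ propagated literals (existential literals or $\bot$, the latter only as last element: a conflict). $\mathcal{T}[s,t]$ is the initial segment ending at $p_{(s,t)}$ (at $d_s$ if $t=0$; $\mathcal{T}[0,0]$ empty); $|\mathcal{T}|$ = number of elements. Policy RED: each $p_{(i,j)}$ has an antecedent $\mathrm{ante}(p_{(i,j)})\in\phi$ with $\mathrm{red}(\mathrm{ante}(p_{(i,j)})|_{\mathcal{T}[i,j-1]})=(p_{(i,j)})$ ($(\bot)$ = empty clause). Policy LEV-ORD: $\mathrm{lv}(d_i)\le\mathrm{lv}(x)$ for all variables $x$ of $\phi$ unassigned in $\mathcal{T}[i-1,g_{i-1}]$. A clause $C$ is unit if $\mathrm{red}(C)=(x)$, $x$ existential, or $\mathrm{red}(C)$ empty ($x=\bot$). Natural condition at an initial segment without $\bot$: if some clauses of the current clause set are unit under it, the next element is the literal of one of them with that clause as antecedent, and is $\bot$ if possible. Learnable clauses of a trail ending in $\bot$: $C_{(r,g_r)}=\mathrm{red}(\mathrm{ante}(\bot))$; leftwards over propagated $p$, with $C'$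 the clause of the next propagated literal to the right, the clause of $p$ is $\mathrm{red}(C'\otimes_p\mathrm{red}(\mathrm{ante}(p)))$ if $\bar p\in C'$, else $C'$; $\mathcal{L}_\mathcal{T}$ is this sequence, each clause with the derivation given by these steps. A $\mathsf{QCDCL}^{\textsf{LEV-ORD}}_{\textsf{RED}}$ proof of $C$ from $\Phi$ is $((\mathcal{T}_1,\dots,\mathcal{T}_m),(C_1,\dots,C_m),(\pi_1,\dots,\pi_m))$: each $\mathcal{T}_i$ a LEV-ORD/RED trail for $\mathcal{Q}\cdot(\phi\cup\{C_1,\dots,C_{i-1}\})$ that has run into a conflict, $C_i\in\mathcal{L}_{\mathcal{T}_i}$ with derivation $\pi_i$, $C_m=C$, $\mathcal{T}_1$ natural, and for $i\ge2$ some $(s,t)$ with $\mathcal{T}_i[s,t]=\mathcal{T}_{i-1}[s,t]$ such that $\mathcal{T}_i$ satisfies the natural condition at all initial segments extending $\mathcal{T}_i[s,t]$. Size $=\sum_i|\mathcal{T}_i|$; refutation if $C=(\bot)$. A long-distance QCDCL resolution proof of $C$ from $\Phi$ is a long-distance Q-resolution proof obtained by concatenating the derivations $\pi_1,\dots,\pi_m$ of some $\mathsf{QCDCL}^{\textsf{LEV-ORD}}_{\textsf{RED}}$ proof of $C$ from $\Phi$. $XT$-property. Let $\Phi=\exists X\forall U\exists T\cdot\phi$ with variable sets $X,U,T$. A clause $C$ is a $T$-clause if its variables meet $T$ but not $X$ or $U$; an $XT$-clause if its variables meet $X$ and $T$ but not $U$. $\Phi$ fulfils the $XT$-property if $\phi$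 contains no $XT$-clause, no unit (one-literal) $T$-clause, and no two $T$-clauses that are resolvable (i.e. contain a complementary pair of literals).
   Formalization: The parenthetical bound for QCDCL refutations is proved as s ≤ 4·(sum of trail lengths), since the literal bound fails: for ∃x∀u∃t.(u) Q-resolution needs 2 clauses but a single trail of length 1 refutes it. The other claims are as stated. *)

(* Defs.v *)
From mathcomp Require Import all_boot.

Set Implicit Arguments.
Unset Strict Implicit.
Unset Printing Implicit Defensive.

Variant quantifier := QExists | QForall.

Definition is_exists (q : quantifier) : bool :=
  if q is QExists then true else false.

Definition qprefix (V : finType) := seq (quantifier * {set V}).

(* [(x, true)] is the literal x and [(x, false)] its negation. *)
Definition lit (V : finType) : finType := (V * bool)%type.

Definition clause (V : finType) : finType := {set lit V}.

Definition neg (V : finType) (l : lit V) : lit V := (l.1, ~~ l.2).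

Definition taut (V : finType) (C : clause V) : bool :=
  [exists l : lit V, (l \in C) && (neg l \in C)].

Definition clause_vars (V : finType) (C : clause V) : {set V} :=
  [set l.1 | l in C].

(* V is the set of all variables of the (closed) formula. *)
Record qcnf (V : finType) := QCNF {
  qblocks : qprefix V;
  qmatrix : {set clause V};
  _ : all (fun b : quantifier * {set V} => b.2 != set0) qblocks;
  _ : pairwise (fun b c : quantifier * {set V} => [disjoint b.2 & c.2]) qblocks;
  _ : sorted (fun b c => is_exists b.1 != is_exists c.1) qblocks;
  _ : forall v : V, has (fun b : quantifier * {set V} => v \in b.2) qblocks;
  _ : forall C, C \in qmatrix -> ~~ taut C
}.

Definition block_index (V : finType) (Q : qprefix V) (v : V) : nat :=
  find (fun b : quantifier * {set V} => v \in b.2) Q.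

Definition lv (V : finType) (Q : qprefix V) (l : lit V) : nat :=
  (block_index Q l.1).+1.

Definition existential (V : finType) (Q : qprefix V) (l : lit V) : bool :=
  is_exists (nth (QExists, set0) Q (block_index Q l.1)).1.

Definition universal (V : finType) (Q : qprefix V) (l : lit V) : bool :=
  ~~ existential Q l.

Definition red (V : finType) (Q : qprefix V) (C : clause V) : clause V :=
  C :\: [set v | universal Q v &
          [forall x : lit V,
             (x \in C) && existential Q x ==> (lv Q x < lv Q v)]].

Definition resolvable (V : finType) (Q : qprefix V) (l : lit V) (C D : clause V)
  : bool :=
  [&& existential Q l, l \in C, neg l \notin C, neg l \in D & l \notin D].

Definition resolvent (V : finType) (l : lit V) (C D : clause V) : clause V :=
  (C :\ l) :|: (D :\ neg l).

(* [ok l D E] is the side condition on resolving D and E over the pivot l. *)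
Variant step (V : finType) (Q : qprefix V) (phi : {set clause V})
    (ok : lit V -> clause V -> clause V -> bool) (prev : seq (clause V))
  : clause V -> Prop :=
| StepAxiom C of C \in phi : step Q phi ok prev C
| StepRes l D E of D \in prev & E \in prev & resolvable Q l D E & ok l D E :
    step Q phi ok prev (resolvent l D E)
| StepRed D of D \in prev : step Q phi ok prev (red Q D).

Definition proof_with (V : finType) (Phi : qcnf V)
    (ok : lit V -> clause V -> clause V -> bool) (C : clause V)
    (pi : seq (clause V)) : Prop :=
  [/\ pi <> [::], last set0 pi = C &
      forall i, i < size pi ->
        step (qblocks Phi) (qmatrix Phi) ok (take i pi) (nth set0 pi i)].

Definition qres_ok (V : finType) (l : lit V) (D E : clause V) : bool :=
  ~~ taut (resolvent l D E).

(* Complementary literals in a long-distance resolvent must be universal, and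
   right of the pivot if their variable occurs in both parents. *)
Definition ldq_ok (V : finType) (Q : qprefix V) (l : lit V) (D E : clause V)
  : bool :=
  [forall u : lit V,
     (u \in resolvent l D E) && (neg u \in resolvent l D E) ==>
     universal Q u &&
     ((u.1 \in clause_vars D) && (u.1 \in clause_vars E) ==>
        (lv Q l < lv Q u))].

Definition qres_proof (V : finType) (Phi : qcnf V) (C : clause V)
    (pi : seq (clause V)) : Prop :=
  proof_with Phi (@qres_ok V) C pi.

Definition ldq_proof (V : finType) (Phi : qcnf V) (C : clause V)
    (pi : seq (clause V)) : Prop :=
  proof_with Phi (ldq_ok (qblocks Phi)) C pi.

Definition qres_refutation (V : finType) (Phi : qcnf V) (pi : seq (clause V))
  : Prop := qres_proof Phi set0 pi.

Definition proof_size (V : finType) (pi : seq (clause V)) : nat := size pi.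

Definition requires_qres_size (V : finType) (Phi : qcnf V) (s : nat) : Prop :=
  forall pi, qres_refutation Phi pi -> s <= proof_size pi.

(* [None] is the value top. *)
Definition restrict (V : finType) (C : clause V) (sigma : seq (lit V))
  : option (clause V) :=
  if has (mem C) sigma then None else Some [set l in C | neg l \notin sigma].

(* A clause is unit with literal [Some x] or, for an empty reduct, with [None],
   which stands for the conflict. *)
Definition unit_clause (V : finType) (Q : qprefix V) (C : clause V)
    (x : option (lit V)) : bool :=
  if x is Some p then existential Q p && (red Q C == [set p])
  else red Q C == set0.

Definition unit_under (V : finType) (Q : qprefix V) (sigma : seq (lit V))
    (C : clause V) (x : option (lit V)) : bool :=
  if restrict C sigma is Some D then unit_clause Q D x else false.

(* A propagated element carries its antecedent; [Propagate None A] is the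
   conflict. *)
Variant entry (V : finType) :=
| Decide of lit V
| Propagate of option (lit V) & clause V.

(* Trails are flat: the double index (s,t) of an element is recovered from the
   positions of the decisions, and the segments T[s,t] are the [take k T]. *)
Definition trail (V : finType) := seq (entry V).

Definition entry_lit (V : finType) (e : entry V) : option (lit V) :=
  match e with Decide d => Some d | Propagate x _ => x end.

Definition trail_lits (V : finType) (T : trail V) : seq (lit V) :=
  pmap (@entry_lit V) T.

(* The trail as a sequence of decided and propagated literals, antecedents
   forgotten. *)
Definition trail_shape (V : finType) (T : trail V)
  : seq (bool * option (lit V)) :=
  [seq (if e is Decide _ then true else false, entry_lit e) | e <- T].

Definition lev_ord (V : finType) (Q : qprefix V) (phi : {set clause V})
    (sigma : seq (lit V)) (d : lit V) : Prop :=
  forall C l, C \in phi -> l \in C -> l.1 \notin [seq m.1 | m <- sigma] ->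
    lv Q d <= lv Q l.

Definition entry_ok (V : finType) (Q : qprefix V) (phi : {set clause V})
    (sigma : seq (lit V)) (e : entry V) : Prop :=
  match e with
  | Decide d => lev_ord Q phi sigma d
  | Propagate x A => A \in phi /\ unit_under Q sigma A x
  end.

Definition is_trail (V : finType) (Q : qprefix V) (phi : {set clause V})
    (T : trail V) : Prop :=
  [/\ uniq [seq l.1 | l <- trail_lits T],
      forall k A, onth T k = Some (Propagate None A) -> k.+1 = size T &
      forall k e, onth T k = Some e ->
        entry_ok Q phi (trail_lits (take k T)) e].

Definition has_conflict (V : finType) (T : trail V) : Prop :=
  exists T' A, T = rcons T' (Propagate None A).

Definition natural_at (V : finType) (Q : qprefix V) (phi : {set clause V})
    (T : trail V) (k : nat) : Prop :=
  let sigma := trail_lits (take k T) in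
  (exists A x, A \in phi /\ unit_under Q sigma A x) ->
  exists A x,
    [/\ onth T k = Some (Propagate x A), A \in phi, unit_under Q sigma A x &
        (exists2 B, B \in phi & unit_under Q sigma B None) -> x = None].

(* For a trail that ends in a conflict, the initial segments without a conflict
   are the [take k T] with [k < size T]. *)
Definition natural_from (V : finType) (Q : qprefix V) (phi : {set clause V})
    (T : trail V) (j : nat) : Prop :=
  forall k, j <= k < size T -> natural_at Q phi T k.

Definition propagations (V : finType) (T : trail V)
  : seq (option (lit V) * clause V) :=
  pmap (fun e => if e is Propagate x A then Some (x, A) else None) T.

(* Acts on pairs of a learnable clause and its derivation. *)
Definition learn_step (V : finType) (Q : qprefix V)
    (c : clause V * seq (clause V)) (xA : option (lit V) * clause V)
  : clause V * seq (clause V) :=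
  let: (C, pi) := c in
  let: (x, A) := xA in
  if x is Some p then
    if neg p \in C then
      let R := resolvent (neg p) C (red Q A) in
      (red Q R, pi ++ [:: A; red Q A; R; red Q R])
    else c
  else c.

Definition learnable (V : finType) (Q : qprefix V) (T : trail V)
  : seq (clause V * seq (clause V)) :=
  if rev (propagations T) is (None, A) :: s then
    let c0 := (red Q A, [:: A; red Q A]) in c0 :: scanl (learn_step Q) c0 s
  else [::].

Record qcdcl (V : finType) := QCDCL {
  trails : seq (trail V);
  learned : seq (clause V);
  derivations : seq (seq (clause V))
}.

Definition qcdcl_clauses (V : finType) (Phi : qcnf V) (rho : qcdcl V) (i : nat)
  : {set clause V} :=
  qmatrix Phi :|: [set C in take i (learned rho)].

(* The policies are LEV-ORD for decisions and RED for propagations. *)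
Definition qcdcl_proof (V : finType) (Phi : qcnf V) (C : clause V)
    (rho : qcdcl V) : Prop :=
  let Q := qblocks Phi in
  let m := size (trails rho) in
  let T i := nth [::] (trails rho) i in
  [/\ 0 < m, size (learned rho) = m, size (derivations rho) = m,
      last set0 (learned rho) = C &
      forall i, i < m ->
        let phi := qcdcl_clauses Phi rho i in
        [/\ is_trail Q phi (T i), has_conflict (T i),
            (nth set0 (learned rho) i, nth [::] (derivations rho) i)
              \in learnable Q (T i) &
            if i is i'.+1 then
              exists j,
                [/\ j <= size (T i), j <= size (T i'),
                    trail_shape (take j (T i)) = trail_shape (take j (T i')) &
                    natural_from Q phi (T i) j]
            else natural_from Q phi (T i) 0]].

Definition qcdcl_refutation (V : finType) (Phi : qcnf V) (rho : qcdcl V)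
  : Prop := qcdcl_proof Phi set0 rho.

Definition qcdcl_size (V : finType) (rho : qcdcl V) : nat :=
  \sum_(T <- trails rho) size T.

Definition ld_qcdcl_proof (V : finType) (Phi : qcnf V) (C : clause V)
    (pi : seq (clause V)) : Prop :=
  ldq_proof Phi C pi /\
  exists2 rho, qcdcl_proof Phi C rho & pi = flatten (derivations rho).

Definition ld_qcdcl_refutation (V : finType) (Phi : qcnf V)
    (pi : seq (clause V)) : Prop := ld_qcdcl_proof Phi set0 pi.

Definition meets (V : finType) (C : clause V) (A : {set V}) : bool :=
  ~~ [disjoint clause_vars C & A].

Definition T_clause (V : finType) (X U T : {set V}) (C : clause V) : bool :=
  [&& meets C T, ~~ meets C X & ~~ meets C U].

Definition XT_clause (V : finType) (X U T : {set V}) (C : clause V) : bool :=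
  [&& meets C X, meets C T & ~~ meets C U].

Definition XT_property (V : finType) (Phi : qcnf V) : Prop :=
  exists X U T,
    [/\ qblocks Phi = [:: (QExists, X); (QForall, U); (QExists, T)],
        forall C, C \in qmatrix Phi -> ~~ XT_clause X U T C,
        forall C, C \in qmatrix Phi -> T_clause X U T C -> #|C| != 1 &
        forall C D l, C \in qmatrix Phi -> D \in qmatrix Phi ->
          T_clause X U T C -> T_clause X U T D -> l \in C -> neg l \notin D].

(* Main.v *)
Require Import Defs.
From mathcomp Require Import all_boot.

(** The clauses that meet [T] but not [U] are never newly derived: resolving over a
    variable of [X] would need such a parent that also meets [X], and resolving
    over a variable of [T] would need two complementary [T]-clauses of the
    matrix. Hence the first literal of a trail outside [X] is a decision (its
    antecedent would be a unit [T]-clause or an [XT]-clause), which LEV-ORD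
    delays until all variables of [X] are assigned, and antecedents of
    [X]-literals do not meet [T]. So in every resolution step of clause learning
    the reduced antecedent is falsified by the trail except at its pivot. The
    current clause is falsified too, except for unassigned literals of the
    conflict clause, which is not a tautology; so no resolvent is. *)

Set Implicit Arguments.
Unset Strict Implicit.
Unset Printing Implicit Defensive.

(** * Literals, reduction, trails and unit clauses *)

Section Literals.
Context {V : finType}.
Implicit Types (l : lit V) (C D : clause V) (Q : qprefix V) (A : {set V}).

Lemma negK : involutive (@neg V).
Proof. by case=> v b; rewrite /neg /= negbK. Qed.

Lemma neg_neq l : neg l != l.
Proof. by case: l => v []; rewrite /neg xpair_eqE eqxx. Qed.

Lemma uniq_var_consistent (sigma : seq (lit V)) l :
  uniq [seq m.1 | m <- sigma] -> l \in sigma -> neg l \notin sigma.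
Proof.
elim: sigma => //= m sigma IH /andP[m_new uniq_s]; rewrite !inE.
have notin q : q.1 = m.1 -> q \notin sigma.
  by move=> eq_qm; apply: contra m_new => q_in; rewrite -eq_qm map_f.
case/orP=> [/eqP->|l_in]; first by rewrite (negPf (neg_neq m)) notin.
rewrite negb_or IH // andbT; apply: contraL l_in => /eqP nl_eq.
by apply: notin; rewrite -nl_eq.
Qed.

Lemma meetsP C A : reflect (exists2 l, l \in C & l.1 \in A) (meets C A).
Proof.
apply: (iffP idP) => [|[l lC lA]].
  rewrite /meets -setI_eq0 => /set0Pn[v /setIP[/imsetP[l lC ->] vA]].
  by exists l.
by rewrite /meets -setI_eq0; apply/set0Pn; exists l.1; rewrite inE lA imset_f.
Qed.

Lemma taut_sub C D : C \subset D -> ~~ taut D -> ~~ taut C.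
Proof.
move/subsetP=> sCD; apply: contra => /existsP[l /andP[lC nlC]].
by apply/existsP; exists l; rewrite !sCD.
Qed.

Lemma red_sub Q C : red Q C \subset C.
Proof. exact: subsetDl. Qed.

Lemma mem_red_existential Q C l :
  existential Q l -> (l \in red Q C) = (l \in C).
Proof. by move=> ex_l; rewrite !inE /universal ex_l. Qed.

Lemma mem_resolvent l m C D :
  (m \in resolvent l C D) =
  (m != l) && (m \in C) || (m != neg l) && (m \in D).
Proof. by rewrite !inE. Qed.

Lemma trail_lits_take_sub (T : trail V) k :
  {subset trail_lits (take k T) <= trail_lits T}.
Proof.
move=> l; rewrite -{2}(cat_take_drop k T) /trail_lits pmap_cat mem_cat.
by move=> ->.
Qed.

Lemma trail_lits_onth (T : trail V) k e l :
  onth T k = Some e -> entry_lit e = Some l -> l \in trail_lits T.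
Proof.
elim: T k => [|a T IH] [|k] //=.
  by case=> -> ->; rewrite inE eqxx.
by move=> /IH{}IH /IH l_in; case: (entry_lit a) => //= m; rewrite inE l_in orbT.
Qed.

(** Lets LEV-ORD be applied at an earlier decision: the variable of entry [k] is still unassigned
    there. *)
Lemma trail_lit_new (T : trail V) j k e l :
  uniq [seq m.1 | m <- trail_lits T] -> onth T k = Some e ->
  entry_lit e = Some l -> j <= k -> l.1 \notin [seq m.1 | m <- trail_lits (take j T)].
Proof.
move=> uniq_T T_k e_l le_jk.
have lt_k: k < size T by rewrite -onthTE T_k.
move: uniq_T T_k; rewrite -{1 2}(cat_take_drop j T) {1}/trail_lits pmap_cat map_cat.
rewrite cat_uniq onth_cat size_takel ?(leq_trans le_jk (ltnW lt_k)) //.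
rewrite ltnNge le_jk /= => /and3P[_ /hasPn new _] T_k; apply: new.
exact/map_f/(trail_lits_onth T_k e_l).
Qed.

Lemma mem_propagations (T : trail V) x (C : clause V) :
  (x, C) \in propagations T -> exists k, onth T k = Some (Propagate x C).
Proof.
elim: T => //= -[d|y D] T IH /=; first by move/IH=> [k eq_k]; exists k.+1.
rewrite inE => /orP[/eqP[-> ->]|/IH[k eq_k]]; first by exists 0.
by exists k.+1.
Qed.

Lemma first_trail_lit (a : pred (lit V)) (T : trail V) :
  has a (trail_lits T) ->
  exists k e q, [/\ onth T k = Some e, entry_lit e = Some q, a q, k < size T &
    ~~ has a (trail_lits (take k T))].
Proof.
elim: T => //= e T IH.
case eq_e: (entry_lit e) => [q|] /=.
  case aq: (a q) => /=; first by exists 0, e, q.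
  move/IH=> [k [e' [q' [? ? ? ? ?]]]]; exists k.+1, e', q'; split=> //=.
  by rewrite eq_e /= aq.
move/IH=> [k [e' [q' [? ? ? ? ?]]]]; exists k.+1, e', q'; split=> //=.
by rewrite eq_e.
Qed.

(** Existential literals survive [red], so an unfalsified one would remain in the reduct, which
    holds at most the unit literal. *)
Lemma unit_under_falsified Q sigma C x l :
  unit_under Q sigma C x -> l \in C -> existential Q l -> Some l != x ->
  neg l \in sigma.
Proof.
rewrite /unit_under /restrict; case: ifP => // _ unitC lC ex_l neq_lx.
apply/negPn/negP => nl_out.
have: l \in red Q [set m in C | neg m \notin sigma].
  by rewrite mem_red_existential // inE lC.
case: x neq_lx unitC => [p|] /= neq_lp.
  by case/andP=> _ /eqP-> /set1P eq_lp; rewrite eq_lp eqxx in neq_lp.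
by move/eqP->; rewrite inE.
Qed.

Lemma unit_under_unsatisfied Q sigma C x l :
  unit_under Q sigma C x -> l \in C -> l \notin sigma.
Proof.
rewrite /unit_under /restrict; case: ifP => // /negbT/hasPn no_sat _ lC.
by apply/negP => /no_sat; rewrite /= lC.
Qed.

Lemma unit_under_existential Q sigma C p :
  unit_under Q sigma C (Some p) -> existential Q p.
Proof. by rewrite /unit_under; case: restrict => //= D /andP[]. Qed.

Lemma unit_under_mem Q sigma C p : unit_under Q sigma C (Some p) -> p \in C.
Proof.
rewrite /unit_under /restrict; case: ifP => //= _ /andP[_ /eqP eq_red].
have /(subsetP (red_sub _ _)): p \in red Q [set l in C | neg l \notin sigma].
  by rewrite eq_red set11.
by rewrite inE => /andP[].
Qed.

End Literals.

(** The index counts steps, so that [P] can carry a size bound on the derivation built so far. *)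
Lemma scanl_invariant (A B : eqType) (f : A -> B -> A) (P : nat -> A -> Prop)
    (s : seq B) n a :
  P n a -> (forall k c x, x \in s -> P k c -> P k.+1 (f c x)) ->
  forall c, c \in a :: scanl f a s -> exists2 k, k <= n + size s & P k c.
Proof.
elim: s n a => [|x s IH] n a Pa step_f c /=.
  by rewrite inE addn0 => /eqP->; exists n.
rewrite inE => /orP[/eqP->|c_in]; first by exists n => //; apply: leq_addr.
rewrite addnS -addSn; apply: IH c_in.
  by apply: step_f => //; rewrite mem_head.
by move=> k b y ys; apply: step_f; rewrite inE ys orbT.
Qed.

(** * Q-resolution derivations *)

Section Derivations.
Context {V : finType} (Phi : qcnf V).
Local Notation Q := (qblocks Phi).
Local Notation phi := (qmatrix Phi).
Local Notation qstep := (step Q phi (@qres_ok V)).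

(** This is [proof_with] without nonemptiness or a prescribed last clause, so that derivations can
    be grown from the empty list. *)
Definition qres_derivation (pi : seq (clause V)) : Prop :=
  forall i, i < size pi -> qstep (take i pi) (nth set0 pi i).

Lemma qres_derivation_rcons pi C :
  qres_derivation pi -> qstep pi C -> qres_derivation (rcons pi C).
Proof.
move=> der_pi step_C i; rewrite size_rcons ltnS => le_i.
rewrite nth_rcons -cats1 takel_cat //; case: ltngtP le_i => // [lt_i _|-> _].
  exact: der_pi.
by rewrite take_size.
Qed.

Lemma qres_derivation_ind (P : clause V -> Prop) pi :
  qres_derivation pi ->
  (forall prev C, (forall D, D \in prev -> P D) -> qstep prev C -> P C) ->
  forall C, C \in pi -> P C.
Proof.
move=> der_pi stepP C /(nthP set0)[i]; elim/ltn_ind: i C => i IH C lt_i <-.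
apply: stepP (der_pi i lt_i) => D /(nthP set0)[j].
rewrite size_take lt_i => lt_ji; rewrite nth_take // => eq_D.
by apply: (IH j lt_ji D _ eq_D); apply: ltn_trans lt_i.
Qed.

Lemma qres_derivation_nontaut pi C :
  qres_derivation pi -> C \in pi -> ~~ taut C.
Proof.
move=> der_pi.
apply: (qres_derivation_ind (P := fun C => ~~ taut C) der_pi) => {C} prev C IH.
case=> [{}C|//|D /IH]; last exact/taut_sub/red_sub.
by case: Phi => ? ? ? ? ? ? nontaut /= /nontaut.
Qed.

(* Clauses that can be appended to the derivation [pi]; the learned clauses are
   reducts of clauses occurring in it. *)
Definition available (pi : seq (clause V)) (C : clause V) : Prop :=
  C \in phi \/ exists2 D, D \in pi & C = red Q D.

Lemma available_step pi C : available pi C -> qstep pi C.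
Proof. by case=> [|[D D_in ->]]; [exact: StepAxiom | exact: StepRed]. Qed.

Lemma available_sub pi pi' C :
  {subset pi <= pi'} -> available pi C -> available pi' C.
Proof. by move=> sub [|[D /sub D_in ->]]; [left | right; exists D]. Qed.

Lemma available_nontaut pi C :
  qres_derivation pi -> available pi C -> ~~ taut C.
Proof.
move=> der_pi av_C; have der := qres_derivation_rcons der_pi (available_step av_C).
by apply: qres_derivation_nontaut der _; rewrite mem_rcons mem_head.
Qed.

End Derivations.

(** * Formulas with the [XT]-property *)

Section XT.
Context {V : finType} {Phi : qcnf V} {X U T : {set V}}.
Local Notation Q := (qblocks Phi).
Local Notation phi := (qmatrix Phi).
Hypothesis Q_XUT : Q = [:: (QExists, X); (QForall, U); (QExists, T)].
Hypothesis no_XT : forall C, C \in phi -> ~~ XT_clause X U T C.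
Hypothesis no_unit_T : forall C, C \in phi -> T_clause X U T C -> #|C| != 1.
Hypothesis no_resolvable_T : forall C D l, C \in phi -> D \in phi ->
  T_clause X U T C -> T_clause X U T D -> l \in C -> neg l \notin D.
Implicit Types (l : lit V) (C D : clause V) (v : V).

(** A case analysis on [varP] rewrites all three memberships and the level together. *)
Variant var_spec v : bool -> bool -> bool -> nat -> Type :=
| VarX : var_spec v true false false 1
| VarU : var_spec v false true false 2
| VarT : var_spec v false false true 3.

Lemma varP v :
  var_spec v (v \in X) (v \in U) (v \in T) (block_index Q v).+1.
Proof.
have := Q_XUT; case: Phi => Q' phi' /= _ + _ + _ eq_Q; rewrite {}eq_Q /= !andbT.
case/andP=> /andP[dXU dXT] dUT /(_ v); rewrite orbF /block_index /=.
case vX: (v \in X) => /=.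
  by rewrite (disjointFr dXU vX) (disjointFr dXT vX) => _; constructor.
case vU: (v \in U) => /=; first by rewrite (disjointFr dUT vU) => _; constructor.
by move=> ->; constructor.
Qed.

Lemma existentialE l : existential Q l = (l.1 \notin U).
Proof.
rewrite /existential; have := varP l.1.
case E: (block_index Q l.1) => [|k]; rewrite Q_XUT /=.
  by case: (l.1 \in U) => // vs; inversion vs.
case: k E => [|[|k]] E /= vs; by inversion vs.
Qed.

(** A literal over [T] is existential of maximal level, so it blocks every universal deletion. *)
Lemma red_meetsT C : meets C T -> red Q C = C.
Proof.
case/meetsP=> t tC tT; apply/setP=> l; rewrite !inE.
case: (boolP (l \in C)) => lC; rewrite ?andbF // andbT negb_and; apply/orP; right.
apply/forallPn; exists t; rewrite tC existentialE /lv negb_imply -leqNgt.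
by case: (varP t.1) tT => //; case: (varP l.1).
Qed.

(** All existential literals of [C] have level 1, below the universal ones, so every universal
    literal is deleted. *)
Lemma red_notmeetsT C l : ~~ meets C T -> l \in red Q C -> l.1 \in X.
Proof.
move=> noT; have notT m : m \in C -> m.1 \notin T.
  by move=> mC; apply: contra noT => mT; apply/meetsP; exists m.
rewrite !inE negb_and /universal negbK existentialE => /andP[+ lC].
case/orP=> [|/forallPn[x]]; first by have := notT l lC; case: (varP l.1).
rewrite negb_imply existentialE -leqNgt /lv => /andP[/andP[/notT + +]].
by have := notT l lC; case: (varP l.1) => //; case: (varP x.1).
Qed.

Lemma qres_derivation_TU pi C :
  qres_derivation Phi pi -> C \in pi -> meets C T -> ~~ meets C U -> C \in phi.
Proof.
move=> der_pi; apply: (qres_derivation_ind (P := fun C =>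
  meets C T -> ~~ meets C U -> C \in phi) der_pi) => {C} prev C IH.
case=> [//|l D E D_in E_in|D D_in]; last first.
  (* The [T]-literal of [red Q D] is already in [D], where it blocks reduction; hence the step
     changes nothing. *)
  move=> meetsT; have meetsDT: meets D T.
    case/meetsP: meetsT => t /(subsetP (red_sub _ _)) tD tT.
    by apply/meetsP; exists t.
  by rewrite red_meetsT //; apply: IH.
case/and5P; rewrite existentialE => lU lD _ nlE _ _ /meetsP[t tR tT] noU.
(* The pivot is existential, so each universal literal of a parent survives in the resolvent. *)
have parent_U F : F = D \/ F = E -> ~~ meets F U.
  move=> eq_F; apply: contra noU => /meetsP[u uF uU]; apply/meetsP; exists u => //.
  have neq_u m : m.1 = l.1 -> u != m.
    by move=> eq_m; apply: contraNneq lU => eq_um; rewrite -eq_m -eq_um.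
  by rewrite mem_resolvent !neq_u //=; case: eq_F => <-; rewrite uF ?orbT.
have parent_T F : F \in prev -> F = D \/ F = E -> meets F T ->
    F \in phi /\ ~~ meets F X.
  move=> F_in eq_F FT; have F_phi := IH F F_in FT (parent_U F eq_F).
  split=> //; apply: contra (no_XT F_phi) => FX.
  by rewrite /XT_clause FX FT parent_U.
have meets_parents (A : {set V}) : l.1 \in A -> meets D A /\ meets E A.
  by move=> lA; split; apply/meetsP; [exists l | exists (neg l)].
have [lX|lT]: l.1 \in X \/ l.1 \in T by case: (varP l.1) lU; auto.
  have [DX EX] := meets_parents X lX.
  (* The parent containing [t] meets [T], and it meets [X] at the pivot. *)
  move: tR; rewrite mem_resolvent => /orP[] /andP[_ tF].
    have DT: meets D T by apply/meetsP; exists t.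
    by have [_ /negP[]] := parent_T D D_in (or_introl erefl) DT.
  have ET: meets E T by apply/meetsP; exists t.
  by have [_ /negP[]] := parent_T E E_in (or_intror erefl) ET.
(* With the pivot in [T], both parents are [T]-clauses of the matrix, with complementary
   literals. *)
have [DT ET] := meets_parents T lT.
have [D_phi DX] := parent_T D D_in (or_introl erefl) DT.
have [E_phi EX] := parent_T E E_in (or_intror erefl) ET.
have /negP[//] : neg l \notin E.
by apply: no_resolvable_T lD; rewrite // /T_clause ?DT ?ET ?DX ?EX ?parent_U //;
  auto.
Qed.

Lemma available_TU pi C : qres_derivation Phi pi -> available Phi pi C ->
  meets C T -> ~~ meets C U -> C \in phi.
Proof.
move=> der_pi av_C; have der := qres_derivation_rcons der_pi (available_step av_C).
by apply: qres_derivation_TU der _; rewrite mem_rcons mem_head.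
Qed.

(** * Antecedents in a LEV-ORD/RED trail *)

Section Trail.
Context {psi : {set clause V}} {tr : trail V}.
Hypothesis psi_TU : forall C, C \in psi -> meets C T -> ~~ meets C U -> C \in phi.
Hypothesis tr_trail : is_trail Q psi tr.

(** As [p] blocks reduction, the restricted clause is already [[set p]], so even universal literals
    other than [p] are falsified. *)
Lemma antecedent_of_T k p C :
  onth tr k = Some (Propagate (Some p) C) -> p.1 \in T ->
  {in C, forall l, l != p -> neg l \in trail_lits (take k tr)}.
Proof.
case: tr_trail => _ _ /[apply] -[_ unitC] pT l lC neq_lp.
have := unitC; rewrite /unit_under /restrict.
case: ifP => //= no_sat /andP[_ /eqP eq_red].
apply/negPn/negP => nl_out; have: l \in [set p]; last by rewrite inE (negPf neq_lp).
rewrite -eq_red red_meetsT ?inE ?lC //; apply/meetsP; exists p => //.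
by apply: (subsetP (red_sub Q _)); rewrite eq_red set11.
Qed.

(* If [C] met [T], a literal outside [X] would precede [p]. *)
Lemma antecedent_of_X k p C :
  onth tr k = Some (Propagate (Some p) C) -> p.1 \in X -> ~~ meets C T.
Proof.
move=> tr_k pX; have [uniq_tr _ tr_ok] := tr_trail.
have [C_psi unitC] := tr_ok _ _ tr_k.
apply/negP => /meetsP[t tC tT].
have nt_in: neg t \in trail_lits (take k tr).
  apply: unit_under_falsified unitC tC _ _.
    by rewrite existentialE; case: (varP t.1) tT.
  by apply: contraTneq tT => -[->]; case: (varP p.1) pX.
have: has (fun l => l.1 \notin X) (trail_lits (take k tr)).
  by apply/hasP; exists (neg t) => //=; case: (varP t.1) tT.
(* [q] is the first trail literal outside [X]; it precedes [p]. *)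
case/first_trail_lit=> j [e [q [ej eq_q /= qX lt_j /hasPn allX]]].
have lt_jk: j < k by apply: leq_trans lt_j _; rewrite size_take; case: ltnP.
rewrite take_takel ?(ltnW lt_jk) // in allX.
have tr_j: onth tr j = Some e by rewrite -(cat_take_drop k tr) onth_cat lt_j.
(* If [q] is propagated, it is in [T] and the rest of its antecedent [B] is falsified by literals
   over [X]. So [B] lies in the matrix, and is either an [XT]-clause or the unit [T]-clause of
   [q]. *)
case: e ej eq_q tr_j => [d|x B] ej /= eq_q tr_j; last first.
  rewrite eq_q in ej tr_j; have [B_psi unitB] := tr_ok _ _ tr_j.
  have qT: q.1 \in T.
    have := unit_under_existential unitB; rewrite existentialE.
    by case: (varP q.1) qX.
  have BX l : l \in B -> l != q -> l.1 \in X.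
    move=> lB neq_lq; have := allX _ (antecedent_of_T tr_j qT lB neq_lq).
    by rewrite negbK.
  have qB := unit_under_mem unitB.
  have BT: meets B T by apply/meetsP; exists q.
  have BU: ~~ meets B U.
    apply/meetsP=> -[u uB uU]; have [eq_uq|neq_uq] := eqVneq u q.
      by move: uU; rewrite eq_uq; case: (varP q.1) qT.
    by have := BX u uB neq_uq; case: (varP u.1) uU.
  have B_phi := psi_TU B_psi BT BU.
  have noBX: ~~ meets B X.
    by apply: contra (no_XT B_phi) => BX'; rewrite /XT_clause BX' BT BU.
  have /negP[] : #|B| != 1 by apply: no_unit_T; rewrite // /T_clause BT noBX BU.
  apply/cards1P; exists q; apply/setP=> l; rewrite inE.
  apply/idP/eqP=> [lB|-> //]; apply/eqP/negPn/negP => neq_lq.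
  by case/negP: noBX; apply/meetsP; exists l => //; apply: BX.
(* If [q] is a decision, LEV-ORD is violated: [p] is unassigned at that point and has level 1, while
   [q] has level at least 2. *)
case: eq_q => eq_dq; have /= := tr_ok _ _ tr_j.
move=> /(_ C p C_psi (unit_under_mem unitC)); rewrite eq_dq.
move=> /(_ (trail_lit_new uniq_tr tr_k erefl (ltnW lt_jk))); rewrite /lv.
by move: pX qX; case: (varP p.1) => //; case: (varP q.1).
Qed.

(** For [p] in [X], reduction leaves only literals over [X], and these are falsified because they
    are existential; for [p] in [T], all of [C] but [p] is falsified. *)
Lemma antecedent_falsified k p C :
  onth tr k = Some (Propagate (Some p) C) ->
  {in red Q C, forall l, l != p -> neg l \in trail_lits tr}.
Proof.
move=> tr_k l l_red neq_lp; have lC := subsetP (red_sub Q C) l l_red.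
apply: (@trail_lits_take_sub _ tr k).
have [_ _ /(_ _ _ tr_k)[_ unitC]] := tr_trail.
have := unit_under_existential unitC; rewrite existentialE => pU.
have [pX|pT]: p.1 \in X \/ p.1 \in T by case: (varP p.1) pU; auto.
  have lX := red_notmeetsT (antecedent_of_X tr_k pX) l_red.
  apply: unit_under_falsified unitC lC _ _.
    by rewrite existentialE; case: (varP l.1) lX.
  by apply: contraNneq neq_lp => -[->].
exact: antecedent_of_T tr_k pT l lC neq_lp.
Qed.

End Trail.

(** * Clause learning as Q-resolution *)

Lemma learnable_qres pre (psi : {set clause V}) tr C pi :
  qres_derivation Phi pre -> (forall D, D \in psi -> available Phi pre D) ->
  is_trail Q psi tr -> has_conflict tr -> (C, pi) \in learnable Q tr ->
  [/\ qres_derivation Phi (pre ++ pi), exists2 D, D \in pi & C = red Q D,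
      last set0 pi = C & size pi <= 4 * size tr].
Proof.
move=> der_pre psi_av tr_trail [tr' [A0 eq_tr]].
have psi_TU D : D \in psi -> meets D T -> ~~ meets D U -> D \in phi.
  by move/psi_av; apply: available_TU.
have psi_nontaut D : D \in psi -> ~~ taut D.
  by move/psi_av; apply: available_nontaut.
have [uniq_tr _ tr_ok] := tr_trail.
have size_props: size (propagations tr) <= size tr.
  by rewrite /propagations size_pmap count_size.
have tr_last: onth tr (size tr') = Some (Propagate None A0).
  by rewrite eq_tr -cats1 onth_cat ltnn subnn.
have [A0_psi unitA0] := tr_ok _ _ tr_last.
(* The conflict contributes no literal, so [A0] is unit under the literals of the whole trail. *)
have lits_last: trail_lits (take (size tr') tr) = trail_lits tr.
  by rewrite eq_tr -cats1 take_size_cat // /trail_lits pmap_cat cats0.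
rewrite lits_last in unitA0.
have props_mem x B : (x, B) \in rev (propagations tr) ->
    exists k, onth tr k = Some (Propagate x B).
  by rewrite mem_rev; apply: mem_propagations.
rewrite -(size_rev (propagations tr)) in size_props.
rewrite /learnable; move: props_mem size_props.
have ->: rev (propagations tr) = (None, A0) :: rev (propagations tr').
  by rewrite eq_tr /propagations -cats1 pmap_cat rev_cat.
set s := rev _ => props_mem size_props.
pose sigma := trail_lits tr.
(* A start of two clauses plus at most four per step gives the bound [4 * n.+1]. The second
   alternative for [l] covers universal literals of [A0] that the restricted reduction deletes but
   [red Q A0] may keep. *)
pose P n (c : clause V * seq (clause V)) :=
  [/\ qres_derivation Phi (pre ++ c.2), exists2 D, D \in c.2 & c.1 = red Q D,
      last set0 c.2 = c.1, size c.2 <= 4 * n.+1 &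
      forall l, l \in c.1 -> neg l \in sigma \/
        [/\ l \in A0, l \notin sigma & neg l \notin sigma]].
move=> /(scanl_invariant (P := P) (n := 0)) []; last first.
(* [s] omits the conflict, so [k.+1] is at most the number of propagations. *)
- move=> k le_k [? ? ? le_size _]; split=> //.
  by apply: leq_trans le_size _; rewrite leq_mul2l /=; apply: leq_trans size_props.
- move=> k [D pi'] [[p|] B] pB_in.
    have [j tr_j] : exists j, onth tr j = Some (Propagate (Some p) B).
      by apply: props_mem; rewrite inE pB_in orbT.
    have [B_psi unitB] := tr_ok _ _ tr_j.
    have p_in: p \in sigma by apply: trail_lits_onth tr_j _.
    rewrite /P /learn_step /=; case: ifP => [npD|_]; last first.
      case=> der red_D last_pi size_pi D_lits; split=> //.
      by apply: leq_trans size_pi _; rewrite leq_mul2l /=.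
    case=> der _ last_pi size_pi D_lits; set R := resolvent _ _ _.
    have R_lits l : l \in R -> neg l \in sigma \/
        [/\ l \in A0, l \notin sigma & neg l \notin sigma].
      rewrite mem_resolvent negK => /orP[/andP[_ /D_lits //]|/andP[neq_lp lB]].
      by left; apply: antecedent_falsified psi_TU tr_trail _ _ _ tr_j _ lB neq_lp.
    (* For a complementary pair in [R], either the trail contains both literals, or one is both
       assigned and unassigned, or both lie in [A0]. *)
    have R_nontaut: ~~ taut R.
      apply/existsP=> -[l /andP[/R_lits lR /R_lits]]; rewrite negK.
      case: lR => [nl_in|[lA0 l_out nl_out]].
        case=> [l_in|[_ /negP[] //]].
        by have := uniq_var_consistent uniq_tr l_in; rewrite nl_in.
      case=> [l_in|[nlA0 _ _]]; first by rewrite l_in in l_out.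
      by case/existsP: (psi_nontaut _ A0_psi); exists l; rewrite lA0.
    (* The trail satisfies [p], so [p] is neither falsified nor unassigned. *)
    have pD: p \notin D.
      apply/negP => /D_lits[np_in|[_ /negP[] //]].
      by have := uniq_var_consistent uniq_tr p_in; rewrite np_in.
    have pB := unit_under_mem unitB.
    have ex_p := unit_under_existential unitB.
    have ex_np : existential Q (neg p) := ex_p.
    have res: resolvable Q (neg p) D (red Q B).
      rewrite /resolvable negK npD pD ex_np mem_red_existential // pB /=.
      apply: contra (psi_nontaut _ B_psi) => /(subsetP (red_sub Q B)) npB.
      by apply/existsP; exists p; rewrite pB.
    have D_pi: D \in pi'.
      move: npD; rewrite -last_pi.
      by case: (pi') => [|E pi''] /=; [rewrite inE | rewrite mem_last].
    split; rewrite ?last_cat //.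
    + rewrite catA; set pre' := pre ++ pi' in der *.
      have {}D_pi: D \in pre' by rewrite mem_cat D_pi orbT.
      have {}psi_av: available Phi pre' B.
        by apply: available_sub (psi_av _ B_psi) => E; rewrite mem_cat => ->.
      rewrite -!cat_rcons cats0.
      apply: qres_derivation_rcons; last first.
        by apply: StepRed; rewrite mem_rcons mem_head.
      apply: qres_derivation_rcons; last first.
        by apply: StepRes => //; rewrite !(mem_rcons, inE) ?D_pi ?eqxx ?orbT.
      apply: qres_derivation_rcons; last first.
        by apply: StepRed; rewrite mem_rcons mem_head.
      (* [B] is an axiom or, if learned earlier, the reduct of a clause in [pre]. *)
      exact: qres_derivation_rcons der (available_step psi_av).
    + by exists R; rewrite // mem_cat !inE eqxx !orbT.
    + by rewrite size_cat /= mulnS addnC leq_add2l.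
    + by move=> l /(subsetP (red_sub Q R)) /R_lits.
  rewrite /P /=; case=> der red_D last_pi size_pi D_lits; split=> //.
  by apply: leq_trans size_pi _; rewrite leq_mul2l /=.
- split=> /=.
  + rewrite -cat_rcons cats1; apply: qres_derivation_rcons.
      by apply: qres_derivation_rcons => //; apply/available_step/psi_av.
    by apply: StepRed; rewrite mem_rcons mem_head.
  + by exists A0; rewrite ?mem_head.
  + by [].
  + by [].
  + move=> l /(subsetP (red_sub Q A0)) lA0.
    (* A literal of [A0] that is not falsified is unassigned, since a unit clause is not
       satisfied. *)
    case: (boolP (neg l \in sigma)) => [|nl_out]; [by left | right].
    by split=> //; apply: unit_under_unsatisfied unitA0 lA0.
Qed.

(** Each trail extends the concatenation, which makes its learned clause available to the next one.
    The bound [i <= size pi] later shows that the whole concatenation is nonempty. *)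
Lemma qcdcl_proof_prefix C rho i : qcdcl_proof Phi C rho ->
  i <= size (trails rho) ->
  let pi := flatten (take i (derivations rho)) in
  [/\ qres_derivation Phi pi, i <= size pi,
      forall D, D \in take i (learned rho) -> available Phi pi D,
      last set0 pi = last set0 (take i (learned rho)) &
      size pi <= 4 * \sum_(tr <- take i (trails rho)) size tr].
Proof.
case=> _ size_l size_d _ rho_ok; elim: i => [|i IH] lt_i /=.
  (* Both occurrences of [last] take the default [set0] here. *)
  by rewrite !take0 big_nil.
have [der_pi le_i av_pi _ size_pi] := IH (ltnW lt_i).
have [tr_ok tr_conf learn _] := rho_ok i lt_i.
move: learn; set C' := nth _ (learned rho) i; set pi' := nth _ _ i => learn.
have psi_av D : D \in qcdcl_clauses Phi rho i ->
    available Phi (flatten (take i (derivations rho))) D.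
  by rewrite !inE => /orP[D_phi|/av_pi //]; left.
have [der [D D_in eq_D] last_pi size_pi'] :=
  learnable_qres der_pi psi_av tr_ok tr_conf learn.
rewrite (take_nth [::]) ?size_d // (take_nth set0) ?size_l // (take_nth [::] lt_i).
rewrite flatten_rcons last_rcons -/C' -/pi'; split=> //.
- rewrite size_cat -addn1 leq_add //.
  by case: (pi') D_in.
- move=> E; rewrite mem_rcons inE => /orP[/eqP->|/av_pi].
    by right; exists D; rewrite // mem_cat D_in orbT.
  by apply: available_sub => F; rewrite mem_cat => ->.
- by rewrite last_cat; move: last_pi; case: (pi') D_in.
- by rewrite size_cat -cats1 big_cat big_seq1 mulnDr leq_add.
Qed.

Lemma qcdcl_refutation_qres rho : qcdcl_refutation Phi rho ->
  qres_refutation Phi (flatten (derivations rho)) /\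
  size (flatten (derivations rho)) <= 4 * qcdcl_size rho.
Proof.
move=> ref; have := qcdcl_proof_prefix ref (leqnn _).
case: ref => m_gt0 size_l size_d last_l _.
rewrite /= take_size (take_oversize (s := learned rho)) ?size_l //.
rewrite take_oversize ?size_d // last_l.
case=> der le_m _ last_pi size_pi; split=> //; split=> //.
by case: flatten (leq_trans m_gt0 le_m).
Qed.

End XT.

(** The factor 4 arises because [qcdcl_size] counts trail elements, while one propagation can add
    four clauses to a derivation: the antecedent, its reduct, the resolvent and the reduct of
    that. *)
Theorem theorem5p6 (V : finType) (Phi : qcnf V) (s : nat)
  (hXT : XT_property Phi) (hs : requires_qres_size Phi s) :
  [/\ forall pi, ld_qcdcl_refutation Phi pi -> s <= proof_size pi,
      forall rho, qcdcl_refutation Phi rho -> s <= 4 * qcdcl_size rho &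
      forall pi, ld_qcdcl_refutation Phi pi -> qres_refutation Phi pi].
Proof.
have [X [U [T [Q_XUT no_XT no_unit_T no_res_T]]]] := hXT.
have to_qres := qcdcl_refutation_qres Q_XUT no_XT no_unit_T no_res_T.
have ld_qres pi : ld_qcdcl_refutation Phi pi -> qres_refutation Phi pi.
  by case=> _ [rho /to_qres[ref _] ->].
split=> // [pi /ld_qres/hs //|rho /to_qres[/hs le_s le_size]].
exact: leq_trans le_s le_size.
Qed.
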